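(* Let $\mathcal{M}$ be an $n$-dimensional $C^1$-manifold, $S\subset\mathcal{M}$ a nonempty set, $x\in S$, and let $(U,\varphi)$ and $(V,\psi)$ be two coordinate charts of $\mathcal{M}$ at $x$. Then $$(\mathrm{d}\varphi_x)^{-1}\big(\mathrm{T}_{\varphi(S\cap U)}(\varphi(x))\big)=(\mathrm{d}\psi_x)^{-1}\big(\mathrm{T}_{\psi(S\cap V)}(\psi(x))\big).$$
   Context: For a nonempty set $S'\subset\mathbb{R}^n$ and $z\in S'$, the (contingent) tangent cone $\mathrm{T}_{S'}(z)$ is the set of all $w\in\mathbb{R}^n$ for which there exist sequences $z_i\in S'$ and $\tau_i>0$ with $z_i\to z$, $\tau_i\searrow0$ and $w=\lim_{i\to\infty}(z_i-z)/\tau_i$. The differential $\mathrm{d}\varphi_x:\mathrm{T}_x\mathcal{M}\to\mathbb{R}^n$ of a chart is a linear isomorphism. *)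

(* Defs.v *)
From HB Require Import structures.
From mathcomp Require Import all_boot all_order all_algebra generic_quotient.
From mathcomp Require Import all_classical all_reals.
From mathcomp Require Import topology normedtype landau sequences derive.

Set Implicit Arguments.
Unset Strict Implicit.
Unset Printing Implicit Defensive.

Import Order.TTheory GRing.Theory Num.Theory.
Import numFieldNormedType.Exports.

Local Open Scope classical_set_scope.
Local Open Scope ring_scope.
Local Open Scope quotient_scope.

Definition tangent_cone (R : realType) (n : nat) (S : set 'rV[R]_n)
    (z : 'rV[R]_n) : set 'rV[R]_n :=
  [set w | exists (z_ : nat -> 'rV[R]_n) (t_ : nat -> R),
    [/\ forall i, S (z_ i),
        forall i, 0 < t_ i,
        z_ @ \oo --> z,
        nonincreasing_seq t_ /\ t_ @ \oo --> (0 : R) &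
        (fun i => (t_ i)^-1 *: (z_ i - z)) @ \oo --> w]].

(* For finite-dimensional V, continuity of y |-> 'd f y v for every v amounts
   to continuity of y |-> 'd f y in operator norm. The notion is used for open
   D only, so that the values of f outside D are irrelevant. *)
Definition C1_on (R : realType) (V W : normedModType R) (D : set V)
    (f : V -> W) : Prop :=
  (forall y, D y -> differentiable f y) /\
  (forall v : V, {within D, continuous (fun y => 'd f y v)}).

(* A homeomorphism from an open subset of M onto an open subset of R^n; the
   two maps are total functions whose values outside these sets are junk. *)
Record chart (R : realType) (n : nat) (M : topologicalType) := Chart {
  chart_dom : set M;
  chart_map :> M -> 'rV[R]_n;
  chart_inv : 'rV[R]_n -> M;
  chart_open_dom : open chart_dom;
  chart_open_img : open (chart_map @` chart_dom);
  chart_mapK : forall p, chart_dom p -> chart_inv (chart_map p) = p;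
  chart_map_continuous : {within chart_dom, continuous chart_map};
  chart_inv_continuous :
    {within chart_map @` chart_dom, continuous chart_inv} }.

Definition C1_compatible (R : realType) (n : nat) (M : topologicalType)
    (c d : chart R n M) : Prop :=
  C1_on (c @` (chart_dom c `&` chart_dom d)) (d \o chart_inv c) /\
  C1_on (d @` (chart_dom c `&` chart_dom d)) (c \o chart_inv d).

(* The atlas is the maximal one, so its members are all the charts of the
   C^1-structure. *)
Record C1_manifold (R : realType) (n : nat) := C1Manifold {
  manifold_space :> topologicalType;
  manifold_hausdorff : hausdorff_space manifold_space;
  manifold_second_countable : @second_countable manifold_space;
  atlas : set (chart R n manifold_space);
  atlas_cover : forall p, exists2 c, atlas c & chart_dom c p;
  atlas_compatible : forall c d, atlas c -> atlas d -> C1_compatible c d;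
  atlas_maximal :
    forall c, (forall a, atlas a -> C1_compatible a c) -> atlas c }.

Definition chart_at (R : realType) (n : nat) (M : C1_manifold R n) (x : M)
    (c : chart R n M) : Prop :=
  atlas c /\ chart_dom c x.

(* Only the restriction of the curve to ]-r, r[ is meaningful. *)
Record C1_curve (R : realType) (n : nat) (M : C1_manifold R n) (x : M) :=
  C1Curve {
  curve_map :> R -> M;
  curve_radius : R;
  curve_radius_gt0 : 0 < curve_radius;
  curve_map0 : curve_map 0 = x;
  curve_continuous :
    {within `]- curve_radius, curve_radius[%classic, continuous curve_map};
  curve_C1 : forall c : chart R n M, atlas c ->
    C1_on (`]- curve_radius, curve_radius[%classic `&`
             curve_map @^-1` chart_dom c) (c \o curve_map : R -> 'rV[R]_n) }.

HB.instance Definition _ (R : realType) (n : nat) (M : C1_manifold R n)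
  (x : M) := gen_eqMixin (C1_curve x).
HB.instance Definition _ (R : realType) (n : nat) (M : C1_manifold R n)
  (x : M) := gen_choiceMixin (C1_curve x).

Definition same_velocity (R : realType) (n : nat) (M : C1_manifold R n) (x : M)
    (g h : C1_curve x) : bool :=
  `[< forall c : chart R n M, chart_at x c ->
        derive1 (c \o g) 0 = derive1 (c \o h) 0 >].

Lemma same_velocity_equiv (R : realType) (n : nat) (M : C1_manifold R n)
  (x : M) : equiv_class_of (@same_velocity R n M x).
Proof.
split=> [g|g h|g h k]; first exact/asboolP.
- by apply/asboolP/asboolP => H c cx; rewrite H.
- by move=> /asboolP gh /asboolP hk; apply/asboolP => c cx; rewrite gh ?hk.
Qed.

Canonical same_velocity_equivRel (R : realType) (n : nat)
    (M : C1_manifold R n) (x : M) :=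
  EquivRelPack (@same_velocity_equiv R n M x).

Definition tangent_space (R : realType) (n : nat) (M : C1_manifold R n)
    (x : M) := {eq_quot (@same_velocity R n M x)}.

Definition chart_diff (R : realType) (n : nat) (M : C1_manifold R n)
    (c : chart R n M) (x : M) (v : tangent_space x) : 'rV[R]_n :=
  derive1 (c \o (repr v : C1_curve x)) 0.

Arguments chart_diff {R n M} c x v.

Fact near_diff (R : realType) (V W : normedModType R) (f g : V -> W) (x : V) :
  (\forall y \near x, f y = g y) -> differentiable f x ->
  differentiable g x /\ 'd g x = 'd f x :> (V -> W).
Proof.
move=> fg df.
have fgx : f x = g x by exact: nbhs_singleton fg.
have H : g \o shift x = cst (g x) + 'd f x +o_ 0 id.
  have /diff_locallyP[_ /eqaddoP E] := df; apply/eqaddoP => e e0.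
  have fg0 : \forall y \near (0 : V), f (y + x) = g (y + x).
    by move/nbhs0P: fg; apply: filterS => y /=; rewrite addrC.
  near=> y.
  have fgy : f (y + x) = g (y + x) by near: y.
  have : `|(f \o shift x - (cst (f x) + 'd f x)) y| <= e * `|y|.
    by near: y; exact: E.
  by rewrite !fctE /= -fgx fgy.
have dE := diff_unique (diff_continuous df) H.
split=> //; apply/diff_locallyP; rewrite dE; split => //; exact: diff_continuous.
Unshelve. all: by end_near. Qed.

Fact near_continuous (T U : topologicalType) (f g : T -> U) (x : T) :
  (\forall y \near x, f y = g y) ->
  {for x, continuous f} -> {for x, continuous g}.
Proof.
move=> fg; rewrite /prop_for /continuous_at -(nbhs_singleton fg).
by apply: cvg_trans; apply: near_eq_cvg.
Qed.

Fact chart_open_overlap (R : realType) (n : nat) (M : topologicalType)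
  (c d : chart R n M) : open (c @` (chart_dom c `&` chart_dom d)).
Proof.
have oi := @chart_open_img _ _ _ c.
have := @chart_inv_continuous _ _ _ c; rewrite continuous_open_subspace//.
move=> /(continuous_inP _ oi)/(_ _ (chart_open_dom d)); congr open.
apply/seteqP; split=> [_ [[p cp <-]]|_ [p [cp dp] <-]] /=.
  by rewrite chart_mapK// => dp; exists p.
by split; [exists p|rewrite chart_mapK].
Qed.

Fact curve_at0 (R : realType) (n : nat) (M : C1_manifold R n) (x : M)
  (g : C1_curve x) (A : set M) : open A -> A x -> \forall t \near (0:R), A (g t).
Proof.
move=> oA Ax; have r0 := curve_radius_gt0 g.
have := @curve_continuous _ _ _ _ g; rewrite continuous_open_subspace//.
have I0 : (0 : R) \in `]- curve_radius g, curve_radius g[%classic.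
  by rewrite inE /= in_itv /= r0 oppr_lt0 r0.
move=> /(_ 0 I0); apply; rewrite curve_map0; exact: open_nbhs_nbhs.
Qed.

Fact curve_differentiable (R : realType) (n : nat) (M : C1_manifold R n) (x : M)
  (c : chart R n M) (g : C1_curve x) :
  chart_at x c -> differentiable (c \o g : R -> 'rV[R]_n) 0.
Proof.
move=> [ac cx]; apply: (curve_C1 g ac).1; split => /=.
  by rewrite in_itv /= oppr_lt0 curve_radius_gt0.
by rewrite curve_map0.
Qed.

Fact transition_differentiable (R : realType) (n : nat) (M : C1_manifold R n)
  (x : M) (c d : chart R n M) : chart_at x c -> chart_at x d ->
  differentiable (d \o chart_inv c) (c x).
Proof.
move=> [ac cx] [ad dx]; apply: (atlas_compatible ac ad).1.1.
by exists x.
Qed.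

Fact velocity_change (R : realType) (n : nat) (M : C1_manifold R n) (x : M)
  (c d : chart R n M) (g : C1_curve x) : chart_at x c -> chart_at x d ->
  derive1 (d \o g) 0 = 'd (d \o chart_inv c) (c x) (derive1 (c \o g) 0).
Proof.
move=> xc xd; have dc := curve_differentiable g xc.
have dt := transition_differentiable xc xd.
rewrite !derive1E' //; last exact: curve_differentiable.
have dt0 : differentiable (d \o chart_inv c) ((c \o g) 0).
  by rewrite /= curve_map0.
have E : \forall t \near (0 : R),
    ((d \o chart_inv c) \o (c \o g)) t = (d \o g) t.
  have := curve_at0 g (chart_open_dom c) xc.2; apply: filterS => t ct /=.
  by rewrite chart_mapK.
have dcg : differentiable ((d \o chart_inv c) \o (c \o g) : R -> 'rV[R]_n) 0.
  exact: differentiable_comp.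
have [_ H] := @near_diff R R 'rV[R]_n _ _ _ E dcg.
apply: etrans (congr1 (fun h : R -> 'rV[R]_n => h 1) H) _.
apply: etrans (congr1 (fun h : R -> 'rV[R]_n => h 1) (diff_comp dc dt0)) _.
by rewrite /= curve_map0.
Qed.

Fact exists_curve (R : realType) (n : nat) (M : C1_manifold R n) (x : M)
  (c : chart R n M) (v : 'rV[R]_n) : chart_at x c ->
  exists g : C1_curve x, derive1 (c \o g) 0 = v.
Proof.
move=> xc; pose line (t : R) : 'rV[R]_n := c x + t *: v.
have line_cont : continuous line.
  by move=> t; apply: cvgD; [exact: cvg_cst|apply: cvgZl; exact: cvg_id].
have line_is_diff t : is_diff t line (fun s => s *: v).
  have H := @is_diffD R R 'rV[R]_n (cst (c x)) (fun s : R => s *: v) _ _ t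
    (is_diff_cst (c x) t) (is_diff_scalel t v).
  by apply: (is_diff_eq H); rewrite add0r.
have oI := @chart_open_img _ _ _ c.
have nearI : \forall t \near (0 : R), (c @` chart_dom c) (line t).
  apply: line_cont; rewrite /line scale0r addr0; apply: open_nbhs_nbhs.
  by split=> //; exists x => //; exact: xc.2.
have /nbhs_ballP[r /= r0 hr] := nearI.
have lr t : `]-r, r[%classic t -> (c @` chart_dom c) (line t).
  rewrite /= in_itv/= => tr; apply: hr; rewrite -ball_normE /= sub0r normrN.
  by rewrite ltr_norml.
have lc : {within `]-r, r[%classic, continuous (chart_inv c \o line)}.
  rewrite continuous_open_subspace// => t; rewrite inE => tr.
  apply: continuous_comp; first exact: line_cont.
  have := @chart_inv_continuous _ _ _ c; rewrite continuous_open_subspace//; apply.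
  by rewrite inE; exact: lr.
have l0 : (chart_inv c \o line) 0 = x.
  by rewrite /= /line scale0r addr0 chart_mapK//; exact: xc.2.
have C1 (d : chart R n M) : atlas d ->
  C1_on (`]- r, r[%classic `&` (chart_inv c \o line) @^-1` chart_dom d)
    (d \o (chart_inv c \o line) : R -> 'rV[R]_n).
  move=> ad; have [dt dc] := (atlas_compatible xc.1 ad).1.
  have lO t : (`]- r, r[%classic `&` (chart_inv c \o line) @^-1` chart_dom d) t ->
      (c @` (chart_dom c `&` chart_dom d)) (line t).
    by move=> [/lr[p cp /= <-]]; rewrite /= chart_mapK// => dp; exists p.
  have dd t : (`]- r, r[%classic `&` (chart_inv c \o line) @^-1` chart_dom d) t ->
      differentiable (d \o (chart_inv c \o line) : R -> 'rV[R]_n) t /\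
      forall w, 'd (d \o (chart_inv c \o line) : R -> 'rV[R]_n) t w =
      'd (d \o chart_inv c) (line t) (w *: v).
    move=> /lO tO; have [] := line_is_diff t => dl lE.
    rewrite [_ \o _](_ : _ = (d \o chart_inv c) \o line)//; split.
      by apply: differentiable_comp => //; exact: dt.
    move=> w; have dtl := dt _ tO.
    apply: etrans (congr1 (fun h : R -> 'rV[R]_n => h w) (diff_comp dl dtl)) _.
    by rewrite /= lE.
  have oD : open (`]- r, r[%classic `&` (chart_inv c \o line) @^-1` chart_dom d).
    have [H _] := @continuous_inP _ _ `]- r, r[%classic (chart_inv c \o line) ltac:(done).
    apply: H; last exact: chart_open_dom.
    by move: lc; rewrite continuous_open_subspace.
  split=> [t /dd[]//|w].
  rewrite continuous_open_subspace// => t; rewrite inE => tD.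
  have cO : {for t, continuous (fun s => 'd (d \o chart_inv c) (line s) (w *: v))}.
    apply: (@continuous_comp _ _ _ line (fun p => 'd (d \o chart_inv c) p (w *: v))).
      exact: line_cont.
    have := dc (w *: v); rewrite continuous_open_subspace; last exact: chart_open_overlap.
    by apply; rewrite inE; exact: lO.
  apply: near_continuous cO; have := open_nbhs_nbhs (conj oD tD).
  by apply: filterS => s sD; exact: esym ((dd s sD).2 w).
exists (C1Curve r0 l0 lc C1).
rewrite derive1E'; last first.
  by apply: (curve_differentiable (C1Curve r0 l0 lc C1)).
have [dl lE] := line_is_diff 0.
have E : \forall t \near (0 : R), line t = (c \o (chart_inv c \o line)) t.
  by apply: filterS nearI => t [p cp /= <-]; rewrite chart_mapK.
have [_ H] := @near_diff R R 'rV[R]_n _ _ _ E dl.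
apply: etrans (congr1 (fun h : R -> 'rV[R]_n => h 1) H) _.
by rewrite lE scale1r.
Qed.

Fact chart_diff_pi (R : realType) (n : nat) (M : C1_manifold R n) (x : M)
  (c : chart R n M) (g : C1_curve x) : chart_at x c ->
  chart_diff c x (\pi_(tangent_space x) g) = derive1 (c \o g) 0.
Proof.
move=> xc; rewrite /chart_diff.
have : repr (\pi_(tangent_space x) g) = g %[mod tangent_space x] by rewrite reprK.
by move=> /eqmodP/asboolP; apply.
Qed.

Fact chart_diff_bij (R : realType) (n : nat) (M : C1_manifold R n) (x : M)
  (c : chart R n M) : chart_at x c ->
  bijective (chart_diff c x).
Proof.
move=> xc.
pose h v := \pi_(tangent_space x) (projT1 (cid (exists_curve v xc))).
have hK : cancel h (chart_diff c x).
  by move=> v; rewrite /h chart_diff_pi//; case: cid.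
exists h => // v; have := hK (chart_diff c x v).
rewrite -[v]reprK; elim/quotW: (h _) => g.
rewrite !chart_diff_pi// => gE.
apply/eqmodP/asboolP => d xd.
by rewrite !(velocity_change _ xc xd) gE.
Qed.

(* T_x M carries the vector space structure transported from R^n by the
   differential of some chart at x; by chart_diff_linear and chart_diff_bij it
   makes the differential of every chart at x a linear isomorphism. *)
Fact chart_at_ex (R : realType) (n : nat) (M : C1_manifold R n) (x : M) :
  exists c : chart R n M, chart_at x c.
Proof. by have [c ac cx] := atlas_cover x; exists c. Qed.

Definition tangent_coord (R : realType) (n : nat) (M : C1_manifold R n) (x : M)
    : tangent_space x -> 'rV[R]_n :=
  chart_diff (projT1 (cid (chart_at_ex x))) x.

Fact tangent_coord_ex (R : realType) (n : nat) (M : C1_manifold R n) (x : M) :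
  exists h, cancel (@tangent_coord R n M x) h /\
            cancel h (@tangent_coord R n M x).
Proof.
by case: (chart_diff_bij (projT2 (cid (chart_at_ex x)))) => h h1 h2; exists h.
Qed.

Definition tangent_of_coord (R : realType) (n : nat) (M : C1_manifold R n)
    (x : M) : 'rV[R]_n -> tangent_space x :=
  projT1 (cid (@tangent_coord_ex R n M x)).

Fact tangent_coordK (R : realType) (n : nat) (M : C1_manifold R n) (x : M) :
  cancel (@tangent_coord R n M x) (@tangent_of_coord R n M x).
Proof. by case: (projT2 (cid (@tangent_coord_ex R n M x))). Qed.

Fact tangent_of_coordK (R : realType) (n : nat) (M : C1_manifold R n) (x : M) :
  cancel (@tangent_of_coord R n M x) (@tangent_coord R n M x).
Proof. by case: (projT2 (cid (@tangent_coord_ex R n M x))). Qed.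

HB.instance Definition _ (R : realType) (n : nat) (M : C1_manifold R n)
  (x : M) := Choice.on (tangent_space x).

Definition tangent_zero (R : realType) (n : nat) (M : C1_manifold R n) (x : M)
    : tangent_space x := tangent_of_coord x 0.

Definition tangent_opp (R : realType) (n : nat) (M : C1_manifold R n) (x : M)
    (u : tangent_space x) : tangent_space x :=
  tangent_of_coord x (- tangent_coord u).

Definition tangent_add (R : realType) (n : nat) (M : C1_manifold R n) (x : M)
    (u v : tangent_space x) : tangent_space x :=
  tangent_of_coord x (tangent_coord u + tangent_coord v).

Definition tangent_scale (R : realType) (n : nat) (M : C1_manifold R n) (x : M)
    (a : R) (u : tangent_space x) : tangent_space x :=
  tangent_of_coord x (a *: tangent_coord u).

Fact tangent_addA (R : realType) (n : nat) (M : C1_manifold R n) (x : M) :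
  associative (@tangent_add R n M x).
Proof. by move=> u v w; rewrite /tangent_add !tangent_of_coordK addrA. Qed.

Fact tangent_addC (R : realType) (n : nat) (M : C1_manifold R n) (x : M) :
  commutative (@tangent_add R n M x).
Proof. by move=> u v; rewrite /tangent_add addrC. Qed.

Fact tangent_add0 (R : realType) (n : nat) (M : C1_manifold R n) (x : M) :
  left_id (tangent_zero x) (@tangent_add R n M x).
Proof.
by move=> u; rewrite /tangent_add tangent_of_coordK add0r tangent_coordK.
Qed.

Fact tangent_addN (R : realType) (n : nat) (M : C1_manifold R n) (x : M) :
  left_inverse (tangent_zero x) (@tangent_opp R n M x) (@tangent_add R n M x).
Proof. by move=> u; rewrite /tangent_add tangent_of_coordK addNr. Qed.

HB.instance Definition _ (R : realType) (n : nat) (M : C1_manifold R n)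
  (x : M) := GRing.isZmodule.Build (tangent_space x)
    (@tangent_addA R n M x) (@tangent_addC R n M x) (@tangent_add0 R n M x)
    (@tangent_addN R n M x).

Fact tangent_scaleA (R : realType) (n : nat) (M : C1_manifold R n) (x : M)
  (a b : R) (u : tangent_space x) :
  tangent_scale a (tangent_scale b u) = tangent_scale (a * b) u.
Proof. by rewrite /tangent_scale tangent_of_coordK scalerA. Qed.

Fact tangent_scale1 (R : realType) (n : nat) (M : C1_manifold R n) (x : M) :
  left_id 1 (@tangent_scale R n M x).
Proof. by move=> u; rewrite /tangent_scale scale1r tangent_coordK. Qed.

Fact tangent_scaleDr (R : realType) (n : nat) (M : C1_manifold R n) (x : M) :
  right_distributive (@tangent_scale R n M x) +%R.
Proof.
by move=> a u v; congr (tangent_of_coord x _); rewrite !tangent_of_coordK scalerDr.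
Qed.

Fact tangent_scaleDl (R : realType) (n : nat) (M : C1_manifold R n) (x : M)
  (u : tangent_space x) :
  {morph (@tangent_scale R n M x)^~ u : a b / a + b}.
Proof.
by move=> a b; congr (tangent_of_coord x _); rewrite !tangent_of_coordK scalerDl.
Qed.

HB.instance Definition _ (R : realType) (n : nat) (M : C1_manifold R n)
  (x : M) := GRing.Zmodule_isLmodule.Build R (tangent_space x)
    (@tangent_scaleA R n M x) (@tangent_scale1 R n M x)
    (@tangent_scaleDr R n M x) (@tangent_scaleDl R n M x).

Fact chart_diff_linear (R : realType) (n : nat) (M : C1_manifold R n) (x : M)
  (c : chart R n M) : chart_at x c -> linear (chart_diff c x).
Proof.
move=> xc a u v; have [x0 E0] : exists c0, chart_at x c0 /\
    forall w : tangent_space x, chart_diff c x w =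
      'd (c \o chart_inv c0) (c0 x) (tangent_coord w).
  rewrite /tangent_coord; case: cid => c0 /= xc0; exists c0; split=> // w.
  exact: velocity_change.
rewrite !E0.2 -linearP; congr ('d _ _ _).
by rewrite [LHS]tangent_of_coordK [X in X + _]tangent_of_coordK.
Qed.

(* Main.v *)
Require Import Defs.
From mathcomp Require Import all_boot all_order all_algebra.
From mathcomp Require Import all_classical all_reals.
From mathcomp Require Import topology normedtype landau sequences derive.

Import Order.TTheory GRing.Theory Num.Theory.
Import numFieldNormedType.Exports.

Local Open Scope classical_set_scope.
Local Open Scope ring_scope.

(** A map f differentiable at z which sends A into B near z sends the tangent
    cone of A at z into that of B at f z under its differential: difference
    quotients (z_i - z) / t_i -> w become (f z_i - f z) / t_i, which differ from
    'd f z ((z_i - z) / t_i) by o(1) since |z_i - z| = O(t_i). Applying this to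
    both transition maps gives both inclusions, because the differential of the
    transition map intertwines the differentials of the charts. *)

Lemma cvg_difference_quotient (R : realType) (V W : normedModType R)
    (f : V -> W) (z w : V) (z_ : nat -> V) (t_ : nat -> R) :
  differentiable f z -> z_ @ \oo --> z ->
  (fun i => (t_ i)^-1 *: (z_ i - z)) @ \oo --> w ->
  (fun i => (t_ i)^-1 *: (f (z_ i) - f z)) @ \oo --> 'd f z w.
Proof.
move=> df cz cw.
have cont := diff_continuous df.
have czB : (fun i => z_ i - z) @ \oo --> (0 : V).
  by rewrite -(subrr z); apply: cvgB cz (cvg_cst _).
have cdf : (fun i => 'd f z ((t_ i)^-1 *: (z_ i - z))) @ \oo --> 'd f z w.
  by apply: (cvg_comp _ _ cw); exact: cont.
rewrite -[X in _ --> X]addr0.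
(* The quotient splits into the differential applied to [(t_ i)^-1 *: (z_ i - z)] and the scaled
   Taylor remainder, which has to vanish in the limit. *)
rewrite (_ : (fun i => _) = (fun i => 'd f z ((t_ i)^-1 *: (z_ i - z)) +
    (t_ i)^-1 *: (f (z_ i) - f z - 'd f z (z_ i - z)))); last first.
  by apply/funext => i; rewrite linearZ/= -[RHS]scalerDr [in RHS]addrC subrK.
apply: cvgD cdf _.
have /diff_locallyP[_ /eqaddoP E] := df.
apply/cvgr0Pnorm_le => e e0.
(* The quotients tend to [w], so [|w| + 1] eventually bounds their norms; the remainder is therefore
   taken with tolerance [e / (|w| + 1)]. *)
have K0 : 0 < `|w| + 1 by rewrite ltr_wpDl.
have d_gt0 : 0 < e / (`|w| + 1) by exact: divr_gt0.
have Ei := czB _ (E _ d_gt0).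
near=> i.
have remainder_le : `|f (z_ i) - f z - 'd f z (z_ i - z)| <=
    e / (`|w| + 1) * `|z_ i - z|.
  have : `|(f \o shift z - (cst (f z) + 'd f z)) (z_ i - z)| <=
      e / (`|w| + 1) * `|z_ i - z| by near: i; exact: Ei.
  by rewrite !fctE /= subrK opprD addrA.
have quotient_le : `|(t_ i)^-1 *: (z_ i - z)| <= `|w| + 1.
  by near: i; apply: cvgr_norm_le cw _ _; rewrite ltrDl.
rewrite normrZ; apply: le_trans (ler_wpM2l (normr_ge0 _) remainder_le) _.
rewrite mulrCA -normrZ -[leRHS](divfK (lt0r_neq0 K0)).
by rewrite ler_wpM2l// ltW.
Unshelve. all: by end_near. Qed.

Lemma tangent_cone_diff (R : realType) (n m : nat) (f : 'rV[R]_n -> 'rV[R]_m)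
    (A : set 'rV[R]_n) (B : set 'rV[R]_m) (z w : 'rV[R]_n) :
  differentiable f z -> (\forall y \near z, A y -> B (f y)) ->
  tangent_cone A z w -> tangent_cone B (f z) ('d f z w).
Proof.
move=> df AB [z_ [t_ [Az t_gt0 cz [t_ni ct] cw]]].
(* [A] is sent into [B] only near [z], while the cone asks for membership at every index: both
   sequences are shifted past the rank [N] from which [z_] stays in that neighbourhood. *)
have [N _ HN] := cz _ AB.
exists (fun i => f (z_ (i + N)%N)), (fun i => t_ (i + N)%N).
have cfz : f \o z_ @ \oo --> f z.
  by apply: (cvg_comp _ _ cz); exact: (differentiable_continuous df).
split=> //.
- by move=> i; apply: HN (Az _); exact: leq_addl.
- by rewrite (cvg_shiftn N (f \o z_)).
- split; first by move=> i j ij; apply: t_ni; rewrite leq_add2r.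
  by rewrite (cvg_shiftn N t_).
- rewrite (cvg_shiftn N (fun i => (t_ i)^-1 *: (f (z_ i) - f z))).
  exact: cvg_difference_quotient.
Qed.

Lemma tangent_cone_chart_change (R : realType) (n : nat) (M : C1_manifold R n)
    (S : set M) (x : M) (c d : chart R n M) :
  chart_at x c -> chart_at x d ->
  chart_diff c x @^-1` tangent_cone (c @` (S `&` chart_dom c)) (c x) `<=`
  chart_diff d x @^-1` tangent_cone (d @` (S `&` chart_dom d)) (d x).
Proof.
move=> xc xd v /= cone_v.
have -> : d x = (d \o chart_inv c) (c x).
  by rewrite /= chart_mapK//; exact: xc.2.
rewrite /chart_diff (velocity_change _ xc xd).
apply: tangent_cone_diff cone_v; first exact: transition_differentiable.
have : nbhs (c x) (c @` (chart_dom c `&` chart_dom d)).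
  apply: open_nbhs_nbhs; split; first exact: chart_open_overlap.
  by exists x => //; split; [exact: xc.2|exact: xd.2].
(* Injectivity of [c] on its domain identifies the point [p] of [S] with [q], which puts [p] in the
   domain of [d]. *)
apply: filterS => _ [q [cq dq] <-] [p [Sp cp] pq]; exists p => /=.
  by split=> //; rewrite -(chart_mapK cp) pq chart_mapK.
by rewrite -pq chart_mapK.
Qed.

Theorem lemmaB1 (R : realType) (n : nat) (M : C1_manifold R n) (S : set M)
    (x : M) (phi psi : chart R n M) :
  S !=set0 -> S x -> chart_at x phi -> chart_at x psi ->
  chart_diff phi x @^-1` tangent_cone (phi @` (S `&` chart_dom phi)) (phi x) =
  chart_diff psi x @^-1` tangent_cone (psi @` (S `&` chart_dom psi)) (psi x).
Proof.
by move=> _ _ xphi xpsi; apply/seteqP; split; exact: tangent_cone_chart_change.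
Qed.
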